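(* Let $q\in[0,1)$. A $\mathbb C^{n\times m}$-valued function $T$ analytic at the origin is $R_q$-cyclic if and only if there exist $N\in\mathbb N_0$ and matrices $(C_q,A_q,B_q)\in\mathbb C^{n\times N}\times\mathbb C^{N\times N}\times\mathbb C^{N\times m}$ such that, in a neighbourhood of the origin, \[ T(z)=C_q\prod_{j=0}^\infty\bigl(I_N-(1-q)zq^jA_q\bigr)^{-1}B_q . \]
   Context: For $q\in(0,1)$, $(R_qf)(z)=\frac{f(z)-f(qz)}{(1-q)z}$ (the $q$-Jackson derivative); $R_0$ is the backward shift $(R_0f)(z)=\frac{f(z)-f(0)}{z}$, $(R_0f)(0)=f'(0)$; these act entrywise. A matrix-valued function $T$ analytic at the origin is called $R_q$-cyclic if the linear span of the columns of the functions $R_q^\ell T$, $\ell=0,1,2,\ldots$, is finite dimensional. Convention $q^0=1$. *)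

(* Defs.v *)
From HB Require Import structures.
From mathcomp Require Import all_boot all_order all_algebra.
From mathcomp Require Import complex.
From mathcomp Require Import all_classical all_reals all_analysis.
Set Implicit Arguments. Unset Strict Implicit. Unset Printing Implicit Defensive.
Import Order.TTheory GRing.Theory Num.Theory ComplexField.
Import numFieldNormedType.Exports.
Local Open Scope ring_scope.
Local Open Scope classical_set_scope.

HB.instance Definition _ (R : realType) := GRing.ComAlgebra.copy R[i] (R[i])^o.
HB.instance Definition _ (R : realType) := Vector.copy R[i] (R[i])^o.
HB.instance Definition _ (R : realType) := NormedModule.copy R[i] (R[i])^o.

Definition analytic0 (R : realType) (n m : nat) (f : R[i] -> 'M[R[i]]_(n, m)) : Prop :=
  exists (a : nat -> 'M[R[i]]_(n, m)) (r : R), 0 < r /\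
    forall z : R[i], `|z| < (r%:C)%C ->
      forall (i : 'I_n) (j : 'I_m),
        (fun K : nat => \sum_(k < K) a k i j * z ^+ k) @ \oo --> f z i j.

(* The operator R_q, acting entrywise:
   (R_q f)(z) = (f(z) - f(qz)) / ((1-q) z) for z <> 0, and (R_q f)(0) = f'(0)
   (complex derivative, entrywise).  For q = 0 this is the backward shift
   (f(z) - f(0))/z with (R_0 f)(0) = f'(0). *)
Definition Rq (R : realType) (q : R) (n m : nat) (f : R[i] -> 'M[R[i]]_(n, m))
  : R[i] -> 'M[R[i]]_(n, m) :=
  fun z => if z == 0 then \matrix_(i, j) ('D_1 (fun w : R[i] => f w i j) 0 : R[i])
           else ((1 - (q%:C)%C) * z)^-1 *: (f z - f ((q%:C)%C * z)).

(* T is R_q-cyclic: the linear span of the columns of R_q^l T (l = 0,1,2,...),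
   viewed as germs at the origin of C^n-valued functions, is finite dimensional,
   i.e. contained in the span of finitely many germs g_0, ..., g_{d-1}. *)
Definition Rq_cyclic (R : realType) (q : R) (n m : nat)
  (T : R[i] -> 'M[R[i]]_(n, m)) : Prop :=
  exists (d : nat) (g : 'I_d -> R[i] -> 'cV[R[i]]_n),
    forall (l : nat) (j : 'I_m), exists c : 'I_d -> R[i],
      \forall z \near (0 : R[i]),
        col j (iter l (@Rq R q n m) T z) = \sum_(k < d) c k *: g k z.

Definition qprod_partial (R : realType) (q : R) (N : nat) (A : 'M[R[i]]_N)
  (z : R[i]) (J : nat) : 'M[R[i]]_N :=
  \prod_(j < J) invmx (1%:M - ((1 - (q%:C)%C) * z * (q%:C)%C ^+ j) *: A).

(* Main.v *)
(** Write [E(z)] for the infinite product; it satisfies [(1 - (1-q) z A) E(z) = E(qz)] and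
    [E(0) = 1], hence [R_q E = A E = E A].  Submultiplicativity of the sum norm shows that the
    product converges and is Lipschitz at [0] as soon as [4 |z| ||A|| <= 1].

    If [T = C E B], then [R_q^l T = C E A^l B], so all columns lie in the span of the [N]
    columns of [C E].  At [z = 0], where [R_q] is a derivative, this follows because both
    sides are continuous at [0].

    Conversely, if the columns of all the [R_q^l T] lie in the span of [d] germs, then their
    coefficient matrices live in a finite-dimensional space, so some [R_q^L T] is a combination
    of the previous ones.  The vector [S] stacking [T, R_q T, ..., R_q^(L-1) T] then satisfies
    [R_q S = A S] for a companion matrix [A], i.e. [(1 - (1-q) z A) S(z) = S(qz)].  Iterating,
    [S(z)] is the [J]-th partial product times [S(q^J z)], which tends to [E(z) S(0)]. *)

Require Import Defs.
From HB Require Import structures.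
From mathcomp Require Import all_boot all_order all_algebra.
From mathcomp Require Import complex.
From mathcomp Require Import ring lra.
From mathcomp Require Import all_classical all_reals all_analysis.
Import Order.TTheory GRing.Theory Num.Theory ComplexField.
Import numFieldNormedType.Exports.
Local Open Scope ring_scope.
Local Open Scope classical_set_scope.

Set Implicit Arguments. Unset Strict Implicit. Unset Printing Implicit Defensive.

(** * Real-valued modulus on the complex numbers and convergence of complex sequences *)

Section ComplexModulus.
Variable R : realType.
Implicit Types (z w : R[i]) (u v : nat -> R[i]).

(** The norm of [R[i]] takes its values in [R[i]]; a modulus valued in [R] puts the estimates in a
    totally ordered field, within reach of [lra] and [nra]. *)
Definition cmod z : R := Normc.normc z.

Lemma normr_mod z : `|z| = ((cmod z)%:C)%C.
Proof. by []. Qed.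

Lemma mod_ge0 z : 0 <= cmod z.
Proof. by case: z => a b; rewrite sqrtr_ge0. Qed.

Lemma mod0 : cmod 0 = 0. Proof. exact: Normc.normc0. Qed.
Lemma mod1 : cmod 1 = 1. Proof. exact: Normc.normc1. Qed.
Lemma modM z w : cmod (z * w) = cmod z * cmod w. Proof. exact: Normc.normcM. Qed.
Lemma modD z w : cmod (z + w) <= cmod z + cmod w. Proof. exact: le_normcD. Qed.
Lemma modN z : cmod (- z) = cmod z. Proof. exact: normcN. Qed.
Lemma mod_eq0 z : cmod z = 0 -> z = 0. Proof. exact: Normc.eq0_normc. Qed.
Lemma modB z w : cmod (z - w) <= cmod z + cmod w.
Proof. by rewrite -[cmod w]modN modD. Qed.
Lemma mod_distC z w : cmod (z - w) = cmod (w - z).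
Proof. by rewrite -modN opprB. Qed.
Lemma mod_dist_trans y z w : cmod (z - w) <= cmod (z - y) + cmod (y - w).
Proof. by rewrite -[z - w](subrKA y) modD. Qed.

Lemma modX z k : cmod (z ^+ k) = cmod z ^+ k.
Proof. by elim: k => [|k IH]; rewrite ?expr0 ?mod1// !exprS modM IH. Qed.

Lemma mod_real (x : R) : 0 <= x -> cmod (x%:C)%C = x.
Proof. by move=> x0; rewrite /cmod/= expr0n addr0 sqrtr_sqr ger0_norm. Qed.

Lemma mod_sum (I : Type) (r : seq I) (P : pred I) (F : I -> R[i]) :
  cmod (\sum_(i <- r | P i) F i) <= \sum_(i <- r | P i) cmod (F i).
Proof.
elim/big_ind2 : _ => [|x a y b xa yb|//]; first by rewrite mod0.
by rewrite (le_trans (modD _ _))// lerD.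
Qed.

Lemma Re_le_mod z : `|complex.Re z| <= cmod z.
Proof.
case: z => a b /=; rewrite -sqrtr_sqr ler_wsqrtr//.
by rewrite lerDl sqr_ge0.
Qed.

Lemma Im_le_mod z : `|complex.Im z| <= cmod z.
Proof.
case: z => a b /=; rewrite -sqrtr_sqr ler_wsqrtr//.
by rewrite lerDr sqr_ge0.
Qed.

Lemma mod_le_ReIm z : cmod z <= `|complex.Re z| + `|complex.Im z|.
Proof.
case: z => a b /=; rewrite -[leRHS]ger0_norm ?addr_ge0// -sqrtr_sqr ler_wsqrtr//.
rewrite sqrrD !real_normK ?num_real// lerD2r lerDl mulrn_wge0// mulr_ge0//.
Qed.

Lemma gt0_realC (e : R[i]) : 0 < e -> exists2 x : R, 0 < x & e = (x%:C)%C.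
Proof.
rewrite ltcE => /andP[/eqP/= i0 r0]; exists (complex.Re e) => //.
by case: e i0 r0 => a b /= -> _.
Qed.

Lemma near0_modP (P : R[i] -> Prop) :
  (\forall z \near (0 : R[i]), P z) <->
  exists2 r : R, 0 < r & forall z, cmod z < r -> P z.
Proof.
split=> [/nbhs_normP[e /= /gt0_realC[x x0 ->] eP]|[r r0 rP]].
  exists x => // z zx; apply: eP => /=.
  by rewrite sub0r normrN normr_mod ltcR.
apply/nbhs_normP; exists (r%:C)%C; first by rewrite /= ltcR.
by move=> z /=; rewrite sub0r normrN normr_mod ltcR; exact: rP.
Qed.

Lemma cvg_modP u (l : R[i]) :
  (u @ \oo --> l) <->
  forall e : R, 0 < e -> exists K, forall k, (K <= k)%N -> cmod (u k - l) < e.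
Proof.
split=> [/cvgrPdist_lt ul e e0|ul].
  have /ul[K _ Kl] : 0 < (e%:C)%C :> R[i] by rewrite ltcR.
  by exists K => k /Kl /=; rewrite normr_mod ltcR mod_distC.
apply/cvgrPdist_lt => _ /gt0_realC[e e0 ->].
have [K KP] := ul _ e0; exists K => // k /= /KP.
by rewrite normr_mod ltcR mod_distC.
Qed.

Lemma cvg_mod_unique u (l l' : R[i]) : u @ \oo --> l -> u @ \oo --> l' -> l = l'.
Proof. exact: cvg_unique. Qed.

Lemma cvg_mod_le u (l c : R[i]) (b : R) :
  u @ \oo --> l -> (forall k, cmod (u k - c) <= b) -> cmod (l - c) <= b.
Proof.
move=> /cvg_modP ul ub; apply/ler_addgt0Pr => e /ul[K /(_ _ (leqnn _))].
rewrite mod_distC => /ltW le_e.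
by rewrite (le_trans (mod_dist_trans (u K) _ _))// addrC lerD.
Qed.

Lemma cvg_mod_bounded u (l : R[i]) :
  u @ \oo --> l -> exists2 M : R, 0 <= M & forall k, cmod (u k) <= M.
Proof.
move=> /cvg_modP/(_ 1 ltr01)[K KP].
exists (1 + cmod l + \sum_(k < K) cmod (u k)).
  by rewrite !addr_ge0 ?mod_ge0// sumr_ge0// => i _; exact: mod_ge0.
move=> k; have [kK|/KP kK] := ltnP k K.
  rewrite (bigD1 (Ordinal kK))//= addrCA lerDl !addr_ge0 ?mod_ge0//.
  by apply: sumr_ge0 => i _; exact: mod_ge0.
rewrite ler_wpDr//; first by apply: sumr_ge0 => i _; exact: mod_ge0.
by rewrite -[u k](subrK l) (le_trans (modD _ _))// lerD2r ltW.
Qed.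

(** The sequence is its first term plus a telescoping series, which the geometric series
    dominates. *)
Lemma real_cvg_geometric_steps (v : nat -> R) (K p : R) : 0 <= p -> p < 1 ->
  (forall k, `|v k.+1 - v k| <= K * p ^+ k) -> cvg (v @ \oo).
Proof.
move=> p0 p1 vK.
have -> : v = (fun n => v 0%N + series (fun k => v k.+1 - v k) n).
  by apply/funext => n; rewrite /series/= telescope_sumr// addrC subrK.
apply: is_cvgD; first exact: is_cvg_cst.
apply: normed_cvg; apply: (@series_le_cvg _ _ (geometric K p)).
- by move=> n /=.
- by move=> n; rewrite /= (le_trans _ (vK n)).
- by move=> n; exact: vK.
- by apply: is_cvg_geometric_series; rewrite ger0_norm.
Qed.

Lemma cvg_geometric_steps u (K p : R) : 0 <= p -> p < 1 ->
  (forall k, cmod (u k.+1 - u k) <= K * p ^+ k) -> exists l : R[i], u @ \oo --> l.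
Proof.
move=> p0 p1 uK.
have /cvg_ex[/= a ha] : cvg ((fun k => complex.Re (u k)) @ \oo).
  apply: (real_cvg_geometric_steps (K := K) p0 p1) => k; rewrite (le_trans _ (uK k))//.
  by rewrite -raddfB Re_le_mod.
have /cvg_ex[/= b hb] : cvg ((fun k => complex.Im (u k)) @ \oo).
  apply: (real_cvg_geometric_steps (K := K) p0 p1) => k; rewrite (le_trans _ (uK k))//.
  by rewrite -raddfB Im_le_mod.
exists (a +i* b)%C; apply/cvg_modP => e e0.
move/cvgrPdist_lt : ha => /(_ (e / 2)).
case=> [|Ka _ Kaa]; first by rewrite divr_gt0.
move/cvgrPdist_lt : hb => /(_ (e / 2)).
case=> [|Kb _ Kbb]; first by rewrite divr_gt0.
exists (maxn Ka Kb) => k; rewrite geq_max => /andP[/Kaa/= ka /Kbb/= kb].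
rewrite (le_lt_trans (mod_le_ReIm _))// [e](splitr e) !raddfB/= ltrD// distrC//.
Qed.

End ComplexModulus.

(** * Scalar power series: Lipschitz bound at the origin, action of [R_q], derivative at the
    origin *)

Section PowerSeries.
Variable R : realType.
Implicit Types (a : nat -> R[i]) (f g : R[i] -> R[i]) (z w : R[i]).

Definition psum a z (K : nat) : R[i] := \sum_(k < K) a k * z ^+ k.

Definition power_series a (r : R) f :=
  forall z, cmod z < r -> psum a z @ \oo --> f z.

Lemma eq_power_series a b r f g : a =1 b -> f =1 g ->
  power_series a r f -> power_series b r g.
Proof. by move=> /funext -> /funext ->. Qed.

(** This regularity is shared by analytic functions and by the entries of [C E B]. It suffices both
    to compare values at 0 and to pass to the limit along [q^J z]. *)
Definition lip0 f := exists (K r : R), [/\ 0 <= K, 0 < r &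
  forall z, cmod z < r -> cmod (f z - f 0) <= K * cmod z].

Lemma cvg_succ (u : nat -> R[i]) (l : R[i]) :
  u @ \oo --> l -> (fun k => u k.+1) @ \oo --> l.
Proof.
by move=> /cvg_modP ul; apply/cvg_modP => e /ul[K KP]; exists K => k /leqW/KP.
Qed.

Lemma psum0 a K : psum a 0 K.+1 = a 0%N.
Proof.
rewrite /psum big_ord_recl expr0 mulr1 big1 ?addr0// => i _.
by rewrite expr0n mulr0.
Qed.

Lemma power_series0 a r f : 0 < r -> power_series a r f -> f 0 = a 0%N.
Proof.
move=> r0 af; have := af 0; rewrite mod0 => /(_ r0)/cvg_succ.
under eq_fun do rewrite psum0.
by move=> /cvg_mod_unique; apply; exact: cvg_cst.
Qed.

(** [a k * r ^+ k] is a difference of consecutive partial sums at [r], and these are bounded because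
    they converge. *)
Lemma psum_coef_bound a (r : R) (l : R[i]) : 0 <= r ->
  psum a (r%:C)%C @ \oo --> l ->
  exists2 M : R, 0 <= M & forall k, cmod (a k) * r ^+ k <= M.
Proof.
move=> r0 /cvg_mod_bounded[M M0 MP]; exists (M + M); first by rewrite addr_ge0.
move=> k; have -> : cmod (a k) * r ^+ k = cmod (psum a (r%:C)%C k.+1 - psum a (r%:C)%C k).
  by rewrite /psum big_ord_recr/= addrAC subrr add0r modM modX mod_real.
by rewrite (le_trans (modB _ _))// lerD.
Qed.

Lemma psum_lip a (r M : R) z : 0 < r -> 0 <= M ->
  (forall k, cmod (a k) * r ^+ k <= M) -> 2 * cmod z <= r ->
  forall K, cmod (psum a z K.+1 - a 0%N) <= (2 * M / r) * cmod z.
Proof.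
move=> r0 M0 aM zr K; set x := cmod z / r.
have x0 : 0 <= x by rewrite divr_ge0 ?mod_ge0 ?ltW.
have x2 : x <= 2^-1 by rewrite ler_pdivrMr// mulrC ler_pdivlMr// mulrC.
have Mx0 : 0 <= M * x by rewrite mulr_ge0.
(* The term of degree [k >= 1] is at most [M x^k <= M x 2^-(k-1)]; the last factor is the exact
   partial sum of this geometric series, so that the induction closes. *)
suff : cmod (psum a z K.+1 - a 0%N) <= M * x * (2 - 2 * 2^-1 ^+ K).
  move=> /le_trans; apply.
  have -> : 2 * M / r * cmod z = M * x * 2 by rewrite /x; ring.
  by rewrite ler_wpM2l// gerBl mulr_ge0// exprn_ge0.
elim: K => [|K IH].
  by rewrite /psum big_ord1/= !expr0 !mulr1 !subrr mod0 mulr0.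
rewrite /psum big_ord_recr/= -/(psum a z K.+1) addrAC (le_trans (modD _ _))//.
have -> : M * x * (2 - 2 * 2^-1 ^+ K.+1) =
    M * x * (2 - 2 * 2^-1 ^+ K) + M * x * 2^-1 ^+ K.
  by rewrite exprS; field.
apply: lerD => //; rewrite modM modX.
have -> : cmod z = r * x by rewrite /x; field; rewrite gt_eqF.
rewrite exprMn mulrA.
apply: (@le_trans _ _ (M * x ^+ K.+1)).
  by rewrite ler_wpM2r// exprn_ge0.
rewrite exprS mulrA ler_wpM2l// lerXn2r// nnegrE// invr_ge0.
Qed.

Lemma power_series_lip0 a r f : 0 < r -> power_series a r f -> lip0 f.
Proof.
move=> r0 af; have r2 : 0 < r / 2 by rewrite divr_gt0.
(* [r / 2] lies strictly inside the disc, so the series converges there; [psum_lip] halves this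
   radius again, whence [r / 4]. *)
have [|M M0 aM] := @psum_coef_bound a (r / 2) (f (((r / 2)%:C)%C)) (ltW r2).
  by apply: af; rewrite mod_real ?ltW// ltr_pdivrMr// mulr_natr mulr2n ltrDl.
exists (2 * M / (r / 2)), (r / 4); split.
- by rewrite !(mulr_ge0, divr_ge0) ?invr_ge0// ltW.
- by rewrite divr_gt0.
move=> z zr; rewrite (power_series0 r0 af).
have zr2 : 2 * cmod z <= r / 2 by lra.
apply: cvg_mod_le (psum_lip r2 M0 aM zr2).
apply/cvg_succ/af; have := mod_ge0 z; lra.
Qed.

Lemma realC_neq1 (q : R) : q < 1 -> 1 - (q%:C)%C != 0 :> R[i].
Proof.
by move=> q1; rewrite subr_eq0 eq_sym; apply: contraTneq q1 => -[->]; rewrite ltxx.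
Qed.

Lemma mod_scale_le (q : R) z : 0 <= q -> q <= 1 -> cmod ((q%:C)%C * z) <= cmod z.
Proof. by move=> q0 q1; rewrite modM mod_real// ler_piMl// mod_ge0. Qed.

(** Termwise, [R_q] sends [z^(k+1)] to [(1 - q^(k+1)) / (1 - q) * z^k]. The value at 0 is written
    [a 1] rather than as a derivative, because [power_series_derive] is itself deduced from the case
    [q = 0]. *)
Lemma power_series_Rq (q : R) a r f : 0 <= q -> q < 1 -> 0 < r ->
  power_series a r f ->
  power_series (fun k => a k.+1 * ((1 - (q%:C)%C ^+ k.+1) / (1 - (q%:C)%C))) r
    (fun z => if z == 0 then a 1%N
              else ((1 - (q%:C)%C) * z)^-1 * (f z - f ((q%:C)%C * z))).
Proof.
move=> q0 q1 r0 af z zr; have q1' := realC_neq1 q1.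
have [->|z0] := eqVneq z 0.
  apply/cvg_modP => e e0; exists 1%N => -[//|k] _.
  by rewrite psum0 expr1 divff// mulr1 subrr mod0.
set qc := (q%:C)%C in q1' *.
have -> : psum (fun k => a k.+1 * ((1 - qc ^+ k.+1) / (1 - qc))) z =
    (fun K => ((1 - qc) * z)^-1 * (psum a z K.+1 - psum a (qc * z) K.+1)).
  apply/funext => K; rewrite /psum -sumrB big_ord_recl !expr0 subrr add0r mulr_sumr.
  apply: eq_bigr => i _; rewrite /= /bump leq0n add1n exprMn !exprS.
  by field; rewrite z0.
apply: cvgM; first exact: cvg_cst.
apply: cvgB; apply: cvg_succ; apply: af => //.
by rewrite (le_lt_trans (mod_scale_le _ _ (ltW _))).
Qed.

(** The difference quotient at 0 is the backward shift of [f], a power series with constant term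
    [a 1], hence Lipschitz at 0. *)
Lemma power_series_derive a r f : 0 < r -> power_series a r f ->
  'D_1 (f : R[i] -> R[i]) 0 = a 1%N.
Proof.
move=> r0 af.
have /power_series_lip0 := power_series_Rq (lexx 0) ltr01 r0 af.
case=> // K [s [K0 s0 KP]].
apply: cvg_lim; first exact: norm_hausdorff.
apply/cvgrPdist_lt => _ /gt0_realC[e e0 ->].
rewrite near_withinE; apply/near0_modP.
(* The [+ 1] keeps the denominator positive when [K = 0]. *)
exists (Num.min s (e / (K + 1))); first by rewrite lt_min s0 divr_gt0// ltr_wpDl.
move=> z; rewrite lt_min => /andP[zs ze] z0.
have := KP _ zs; rewrite eqxx (negbTE z0) mul0r subr0 mul1r => zK.
rewrite /= addr0 [z *: 1]mulr1 normr_mod ltcR mod_distC (le_lt_trans zK)//.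
move: ze; rewrite ltr_pdivlMr ?ltr_wpDl// => ze.
rewrite (le_lt_trans _ ze)// mulrDr mulr1 mulrC lerDl mod_ge0//.
Qed.

End PowerSeries.

(** * Matrix functions analytic at the origin, and their stability under [R_q] *)

Section AnalyticMatrix.
Variable R : realType.

Lemma analytic0_power_series (n m : nat) (f : R[i] -> 'M[R[i]]_(n, m)) :
  analytic0 f <-> exists (a : nat -> 'M[R[i]]_(n, m)) (r : R), 0 < r /\
    forall i j, power_series (fun k => a k i j) r (fun z => f z i j).
Proof.
split=> -[a [r [r0 af]]]; exists a, r; split=> //.
- by move=> i j z zr; apply: af; rewrite normr_mod ltcR.
- by move=> z zr i j; apply: af; rewrite normr_mod ltcR in zr.
Qed.

Lemma analytic0_lip0 (n m : nat) (f : R[i] -> 'M[R[i]]_(n, m)) i j :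
  analytic0 f -> lip0 (fun z => f z i j).
Proof.
by move=> /analytic0_power_series[a [r [r0 af]]]; exact: power_series_lip0 r0 (af i j).
Qed.

Lemma analytic0_Rq (q : R) (n m : nat) (f : R[i] -> 'M[R[i]]_(n, m)) :
  0 <= q -> q < 1 -> analytic0 f -> analytic0 (Rq q f).
Proof.
move=> q0 q1 /analytic0_power_series[a [r [r0 af]]]; apply/analytic0_power_series.
exists (fun k => ((1 - (q%:C)%C ^+ k.+1) / (1 - (q%:C)%C)) *: a k.+1), r.
split; first exact: r0.
move=> i j; apply: eq_power_series (power_series_Rq q0 q1 r0 (af i j)).
  by move=> k; rewrite mxE mulrC.
move=> z; rewrite /Rq; case: ifP => _; last by rewrite !mxE.
by rewrite mxE (power_series_derive r0 (af i j)).
Qed.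

Lemma analytic0_iter_Rq (q : R) (n m : nat) (f : R[i] -> 'M[R[i]]_(n, m)) l :
  0 <= q -> q < 1 -> analytic0 f -> analytic0 (iter l (@Rq R q n m) f).
Proof.
move=> q0 q1 hf; elim: l => [|l IH]; first exact: hf.
by rewrite iterS; apply: (analytic0_Rq q0 q1 IH).
Qed.

(** This extends to [z = 0], where [Rq] is a derivative, the identities obtained by algebra at
    [z != 0]. *)
Lemma lip0_eq (f g : R[i] -> R[i]) (r : R) : lip0 f -> lip0 g -> 0 < r ->
  (forall z, z != 0 -> cmod z < r -> f z = g z) -> f 0 = g 0.
Proof.
move=> [K [s [K0 s0 fK]]] [K' [s' [K'0 s'0 gK]]] r0 fg.
apply/eqP; rewrite -subr_eq0; apply/eqP/mod_eq0/le_anti; rewrite mod_ge0 andbT.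
apply/ler_addgt0Pr => e e0; rewrite add0r.
(* A nonzero test point inside all three radii with [(K + K') x < e]; halving makes the inequalities
   strict. *)
pose x := Num.min (Num.min s s') (Num.min r (e / (K + K' + 1))) / 2.
have K1 : 0 < K + K' + 1 by rewrite ltr_wpDl ?addr_ge0.
have m0 : 0 < Num.min (Num.min s s') (Num.min r (e / (K + K' + 1))).
  by rewrite !lt_min s0 s'0 r0 divr_gt0.
have x0 : 0 < x by rewrite divr_gt0.
have : x < Num.min (Num.min s s') (Num.min r (e / (K + K' + 1))) by rewrite /x; lra.
rewrite !lt_min => /andP[/andP[xs xs'] /andP[xr xe]].
have mx : cmod (x%:C)%C = x by rewrite mod_real// ltW.
have xn0 : (x%:C)%C != 0 :> R[i] by apply: contraTneq x0 => -[->]; rewrite ltxx.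
have := fK (x%:C)%C; have := gK (x%:C)%C; rewrite mx fg ?mx// => /(_ xs') gx /(_ xs) fx.
rewrite (le_trans (mod_dist_trans (g (x%:C)%C) _ _))// mod_distC.
rewrite ltr_pdivlMr// in xe; nra.
Qed.

End AnalyticMatrix.

(** * Sum norm of matrices, inverses near the identity, entrywise convergence *)

Section MatrixSumNorm.
Variable R : realType.

Definition mxs (m n : nat) (A : 'M[R[i]]_(m, n)) : R := \sum_i \sum_j cmod (A i j).

Lemma mxs_ge0 m n (A : 'M[R[i]]_(m, n)) : 0 <= mxs A.
Proof. by apply: sumr_ge0 => i _; apply: sumr_ge0 => j _; exact: mod_ge0. Qed.

Lemma mod_le_mxs m n (A : 'M[R[i]]_(m, n)) i j : cmod (A i j) <= mxs A.
Proof.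
rewrite /mxs (bigD1 i)//= (bigD1 j)//= -addrA lerDl addr_ge0//.
  by apply: sumr_ge0 => k _; exact: mod_ge0.
by apply: sumr_ge0 => k _; apply: sumr_ge0 => l _; exact: mod_ge0.
Qed.

Lemma mxsD m n (A B : 'M[R[i]]_(m, n)) : mxs (A + B) <= mxs A + mxs B.
Proof.
rewrite /mxs -big_split/=; apply: ler_sum => i _.
by rewrite -big_split/=; apply: ler_sum => j _; rewrite mxE modD.
Qed.

Lemma mxsZ m n (w : R[i]) (A : 'M[R[i]]_(m, n)) : mxs (w *: A) = cmod w * mxs A.
Proof.
rewrite /mxs mulr_sumr; apply: eq_bigr => i _.
by rewrite mulr_sumr; apply: eq_bigr => j _; rewrite mxE modM.
Qed.

(** The products [|A i k| |B k j|] with matching inner index are some of the terms of the expanded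
    product of the two sums. *)
Lemma mxsM m n p (A : 'M[R[i]]_(m, n)) (B : 'M[R[i]]_(n, p)) :
  mxs (A *m B) <= mxs A * mxs B.
Proof.
rewrite /mxs mulr_suml; apply: ler_sum => i _.
rewrite mulr_suml.
apply: (@le_trans _ _ (\sum_j \sum_k cmod (A i k) * cmod (B k j))).
  apply: ler_sum => j _; rewrite mxE (le_trans (mod_sum _ _ _))//.
  by apply: ler_sum => k _; rewrite modM.
rewrite exchange_big/=; apply: ler_sum => k _.
rewrite -mulr_sumr ler_wpM2l ?mod_ge0//.
rewrite [leRHS](bigD1 k)//= lerDl; apply: sumr_ge0 => l _.
by apply: sumr_ge0 => j _; exact: mod_ge0.
Qed.

(** A row [v] killed by [1 - B] satisfies [v = v B], so its norm would shrink strictly unless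
    [v = 0]. *)
Lemma unitmx_1B N (B : 'M[R[i]]_N) : mxs B < 1 -> 1%:M - B \in unitmx.
Proof.
move=> B1; rewrite -row_free_unit; apply: inj_row_free => v.
rewrite mulmxBr mulmx1 => /eqP; rewrite subr_eq0 => /eqP vB.
have : mxs v <= mxs v * mxs B by rewrite {1}vB mxsM.
have := mxs_ge0 v; rewrite le_eqVlt => /predU1P[v0 _|v0].
  apply/matrixP => i j; rewrite mxE; apply/mod_eq0/le_anti.
  by rewrite mod_ge0 andbT v0 mod_le_mxs.
by rewrite ler_pMr// leNgt B1.
Qed.

(** The difference [D] solves [D = D B + B], hence [||D|| (1 - ||B||) <= ||B||]. *)
Lemma mxs_invmx_1B N (B : 'M[R[i]]_N) : mxs B <= 2^-1 ->
  mxs (invmx (1%:M - B) - 1%:M) <= 2 * mxs B.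
Proof.
move=> B2; have B1 : mxs B < 1 by lra.
set D := _ - _.
have DE : D = D *m B + B.
  have := mulVmx (unitmx_1B B1); rewrite mulmxBr mulmx1 => VB.
  by rewrite /D mulmxBl mul1mx subrK -{2}VB subKr.
have : mxs D <= mxs D * mxs B + mxs B.
  by rewrite {1}DE (le_trans (mxsD _ _))// lerD2r mxsM.
by have := mxs_ge0 D; nra.
Qed.

Definition mxcvg m n (U : nat -> 'M[R[i]]_(m, n)) (L : 'M[R[i]]_(m, n)) :=
  forall i j, (fun J => U J i j) @ \oo --> L i j.

Lemma mxcvg_unique m n (U : nat -> 'M[R[i]]_(m, n)) L L' :
  mxcvg U L -> mxcvg U L' -> L = L'.
Proof.
by move=> UL UL'; apply/matrixP => i j; exact: cvg_mod_unique (UL i j) (UL' i j).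
Qed.

Lemma mxcvg_cst m n (L : 'M[R[i]]_(m, n)) : mxcvg (fun=> L) L.
Proof. by move=> i j; exact: cvg_cst. Qed.

Lemma mxcvg_succ m n (U : nat -> 'M[R[i]]_(m, n)) L :
  mxcvg U L -> mxcvg (fun J => U J.+1) L.
Proof. by move=> UL i j; exact: cvg_succ (UL i j). Qed.

Lemma cvg_sumC (I : Type) (r : seq I) (F : I -> nat -> R[i]) (l : I -> R[i]) :
  (forall i, F i @ \oo --> l i) ->
  (fun J => \sum_(i <- r) F i J) @ \oo --> \sum_(i <- r) l i.
Proof.
move=> Fl; elim: r => [|k s IH].
  by rewrite big_nil; under eq_fun do rewrite big_nil; exact: cvg_cst.
rewrite big_cons; under eq_fun do rewrite big_cons.
exact: cvgD (Fl k) IH.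
Qed.

Lemma mxcvgM m n p (U : nat -> 'M[R[i]]_(m, n)) (V : nat -> 'M[R[i]]_(n, p)) L M :
  mxcvg U L -> mxcvg V M -> mxcvg (fun J => U J *m V J) (L *m M).
Proof.
move=> UL VM i j; rewrite mxE; under eq_fun do rewrite mxE.
by apply: cvg_sumC => k; apply: cvgM; [exact: UL|exact: VM].
Qed.

End MatrixSumNorm.

(** * The infinite product: convergence, functional equation, commutation with [A] *)

Section QProduct.
Variables (R : realType) (q : R) (N : nat) (A : 'M[R[i]]_N).
Hypotheses (q0 : 0 <= q) (q1 : q < 1).
Implicit Types z : R[i].

Let qc : R[i] := (q%:C)%C.

Definition qfactor z : 'M[R[i]]_N := 1%:M - ((1 - qc) * z) *: A.

(** This is Jackson's q-exponential of [z A], and the resolvent [(1 - z A)^-1] when [q = 0]. Since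
    [lim] is total, the value is meaningful only where the product converges, in particular for
    [small z]. *)
Definition qexp z : 'M[R[i]]_N :=
  \matrix_(i, k) lim ((fun J => qprod_partial q A z J i k) @ \oo).

Lemma mod_1Bq : cmod (1 - qc) = 1 - q.
Proof. by rewrite /qc -(rmorphB (real_complex R)) mod_real// subr_ge0 ltW. Qed.

Lemma mod_qXz z j : cmod (qc ^+ j * z) = q ^+ j * cmod z.
Proof. by rewrite modM modX mod_real. Qed.

Lemma qprod_partialS z J :
  qprod_partial q A z J.+1 = qprod_partial q A z J *m invmx (qfactor (qc ^+ J * z)).
Proof.
by rewrite /qprod_partial big_ord_recr/= /qfactor -[_ * z * _]mulrA [z * _]mulrC.
Qed.

(** Splitting off the first factor, not the last, leaves a partial product at [q z]; its limit is
    the functional equation [qfactor_qexp]. *)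
Lemma qprod_partialSl z J :
  qprod_partial q A z J.+1 = invmx (qfactor z) *m qprod_partial q A (qc * z) J.
Proof.
rewrite /qprod_partial big_ord_recl/= /qfactor expr0 mulr1; congr (_ *m _).
by apply: eq_bigr => i _; rewrite /= /bump leq0n add1n exprS -!mulrA [z * _]mulrCA.
Qed.

(* On this neighbourhood every factor is invertible and the partial products stay within
   sum-norm distance 1 of the identity. *)
Definition small z := 4 * (cmod z * mxs A) <= 1.

Lemma small_contract z w : cmod w <= cmod z -> small z -> small w.
Proof. by rewrite /small => wz; have := ler_wpM2r (mxs_ge0 A) wz; lra. Qed.

Lemma small_qXz z j : small z -> small (qc ^+ j * z).
Proof.
apply: small_contract; rewrite mod_qXz ler_piMl ?mod_ge0//.
by rewrite exprn_ile1// ltW.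
Qed.

Lemma mxs_qfactor z : mxs (((1 - qc) * z) *: A) = (1 - q) * (cmod z * mxs A).
Proof. by rewrite mxsZ modM mod_1Bq mulrA. Qed.

Lemma mxs_qfactor_le z : small z -> mxs (((1 - qc) * z) *: A) <= 2^-1.
Proof.
rewrite mxs_qfactor /small; set t := cmod z * mxs A => t4.
have t0 : 0 <= t by rewrite mulr_ge0 ?mod_ge0 ?mxs_ge0.
by rewrite (@le_trans _ _ t)//; [rewrite ler_piMl// gerBl|lra].
Qed.

Lemma qfactor_unit z : small z -> qfactor z \in unitmx.
Proof. by move=> /mxs_qfactor_le h; apply: unitmx_1B; lra. Qed.

Lemma qprod_partial_bound z J : small z ->
  mxs (qprod_partial q A z J - 1%:M) <= 4 * (cmod z * mxs A) * (1 - q ^+ J) /\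
  mxs (qprod_partial q A z J.+1 - qprod_partial q A z J) <=
    4 * (cmod z * mxs A) * (1 - q) * q ^+ J.
Proof.
move=> zA; set t := cmod z * mxs A.
have t0 : 0 <= t by rewrite mulr_ge0 ?mod_ge0 ?mxs_ge0.
have t1 : 4 * t <= 1 by [].
set P := qprod_partial q A z.
have qJ k : 0 <= q ^+ k <= 1 by rewrite exprn_ge0// exprn_ile1// ltW.
(* The increment is [(P k - 1) D + D], where [||D|| <= 2 (1 - q) q^k t] and [||P k - 1|| <= 1]. It
   thus follows from the distance bound at the same [k], and the induction runs on that bound alone:
   the increments add up to [4 t (1 - q^J)]. *)
have step k : mxs (P k - 1%:M) <= 4 * t * (1 - q ^+ k) ->
    mxs (P k.+1 - P k) <= 4 * t * (1 - q) * q ^+ k.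
  move=> Pk; set D := invmx (qfactor (qc ^+ k * z)) - 1%:M.
  have -> : P k.+1 - P k = (P k - 1%:M) *m D + D.
    by rewrite mulmxBl mul1mx subrK /D mulmxBr mulmx1 /P qprod_partialS.
  have Dk : mxs D <= 2 * ((1 - q) * (q ^+ k * t)).
    have sk := small_qXz k zA.
    rewrite /t [q ^+ k * _]mulrA -mod_qXz -mxs_qfactor; exact: mxs_invmx_1B (mxs_qfactor_le sk).
  have Pk1 : mxs (P k - 1%:M) <= 1.
    by rewrite (le_trans Pk)// (le_trans _ t1)// ler_piMr//; have := qJ k; lra.
  rewrite (le_trans (mxsD _ _))// (@le_trans _ _ (mxs D + mxs D))//; last by lra.
  by rewrite lerD2r (le_trans (mxsM _ _))// ler_piMl// mxs_ge0.
suff PJ : mxs (P J - 1%:M) <= 4 * t * (1 - q ^+ J) by split=> //; exact: step.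
elim: J => [|k IH].
  rewrite expr0 subrr mulr0 /P /qprod_partial big_ord0 subrr /mxs big1// => i _.
  by rewrite big1// => j _; rewrite mxE mod0.
rewrite -[P k.+1](subrK (P k)) -addrA (le_trans (mxsD _ _))//.
by rewrite (le_trans (lerD (step _ IH) IH))// exprS; lra.
Qed.

Lemma qexp_cvg z : small z -> mxcvg (qprod_partial q A z) (qexp z).
Proof.
move=> zA i k; rewrite mxE.
suff /cvg_ex : exists l : R[i], (fun J => qprod_partial q A z J i k) @ \oo --> l by [].
apply: (cvg_geometric_steps (K := 4 * (cmod z * mxs A) * (1 - q)) q0 q1) => J.
have [_] := qprod_partial_bound J zA; apply: le_trans.
by have := mod_le_mxs (qprod_partial q A z J.+1 - qprod_partial q A z J) i k; rewrite !mxE.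
Qed.

Lemma qexp_dist1 z i k : small z ->
  cmod (qexp z i k - (1%:M : 'M[R[i]]_N) i k) <= 4 * (cmod z * mxs A).
Proof.
move=> zA; apply: (cvg_mod_le (qexp_cvg zA (i:=i) (j:=k))) => J.
have [h _] := qprod_partial_bound J zA.
have := mod_le_mxs (qprod_partial q A z J - 1%:M) i k; rewrite !mxE => /le_trans; apply.
apply: le_trans h _; rewrite ler_piMr ?mulr_ge0 ?mod_ge0 ?mxs_ge0//.
by rewrite gerBl exprn_ge0.
Qed.

Lemma small0 : small 0.
Proof. by rewrite /small mod0 mul0r mulr0. Qed.

Lemma qexp0 : qexp 0 = 1%:M.
Proof.
apply/matrixP => i k; apply/eqP; rewrite -subr_eq0; apply/eqP/mod_eq0/le_anti.
by rewrite mod_ge0 andbT (le_trans (qexp_dist1 _ _ small0))// mod0 mul0r mulr0.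
Qed.

Lemma qfactor_qexp z : small z -> qfactor z *m qexp z = qexp (qc * z).
Proof.
move=> zA; apply: mxcvg_unique (_ : mxcvg (qprod_partial q A (qc * z)) _) _.
  have -> : qprod_partial q A (qc * z) =
      (fun J => qfactor z *m qprod_partial q A z J.+1).
    by apply/funext => J; rewrite qprod_partialSl mulKVmx// qfactor_unit.
  by apply: mxcvgM; [exact: mxcvg_cst|exact/mxcvg_succ/qexp_cvg].
by apply: qexp_cvg; rewrite -[qc]expr1 small_qXz.
Qed.

Lemma invmx_comm (M : 'M[R[i]]_N) : A *m M = M *m A -> A *m invmx M = invmx M *m A.
Proof.
(* [invmx] returns a singular matrix unchanged, so there the claim is [AM] itself. *)
move=> AM; have [uM|uM] := boolP (M \in unitmx); last by rewrite invmx_out.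
by rewrite -[LHS](mulKmx uM) [M *m (A *m _)]mulmxA -AM mulmxK.
Qed.

Lemma qexp_comm z : small z -> A *m qexp z = qexp z *m A.
Proof.
move=> zA; apply: mxcvg_unique (_ : mxcvg (fun J => A *m qprod_partial q A z J) _) _.
  by apply: mxcvgM; [exact: mxcvg_cst|exact: qexp_cvg].
have -> : (fun J => A *m qprod_partial q A z J) = (fun J => qprod_partial q A z J *m A).
  apply/funext => J; elim: J => [|J IH].
    by rewrite /qprod_partial big_ord0 mulmx1 mul1mx.
  rewrite qprod_partialS mulmxA IH -!mulmxA; congr (_ *m _); apply: invmx_comm.
  by rewrite /qfactor mulmxBl mulmxBr mulmx1 mul1mx -scalemxAl -scalemxAr.
by apply: mxcvgM; [exact: qexp_cvg|exact: mxcvg_cst].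
Qed.

Lemma near0_small : \forall z \near (0 : R[i]), small z.
Proof.
have A1 : 0 < 4 * (mxs A + 1) by rewrite mulr_gt0// ltr_wpDl ?mxs_ge0.
apply/near0_modP; exists (4 * (mxs A + 1))^-1; first by rewrite invr_gt0.
move=> z; rewrite -[ltRHS]mul1r ltr_pdivlMr// /small => z1.
by have := mod_ge0 z; have := mxs_ge0 A; nra.
Qed.

End QProduct.

(** * The two implications: cyclicity of a realized function, companion realization of a cyclic
    one *)

Section Realization.
Variables (R : realType) (q : R).
Hypotheses (q0 : 0 <= q) (q1 : q < 1).

Let qc : R[i] := (q%:C)%C.

Lemma lip0_cvg (f : R[i] -> R[i]) (z : R[i]) :
  lip0 f -> (fun J => f (qc ^+ J * z)) @ \oo --> f 0.
Proof.
move=> [K [s [K0 s0 fK]]]; apply/cvg_modP => e e0.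
have z1 : 0 < cmod z + 1 by rewrite ltr_wpDl ?mod_ge0.
have K1 : 0 < K + 1 by rewrite ltr_wpDl.
(* Once [q^J] is below this bound, [|q^J z| <= q^J (|z| + 1)] is below both [s] and
   [e / (K + 1)]. *)
have b0 : 0 < Num.min s (e / (K + 1)) / (cmod z + 1).
  by rewrite divr_gt0// lt_min s0 divr_gt0.
have : (fun J => q ^+ J) @ \oo --> 0 by apply: cvg_expr; rewrite ger0_norm.
move=> /cvgrPdist_lt/(_ _ b0)[J0 _ J0P]; exists J0 => J /J0P /=.
rewrite sub0r normrN ger0_norm ?exprn_ge0// ltr_pdivlMr// => qJ.
have : cmod (qc ^+ J * z) < Num.min s (e / (K + 1)).
  rewrite (le_lt_trans _ qJ)// modM modX mod_real// mulrDr lerDl mulr1.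
  by rewrite exprn_ge0.
rewrite lt_min => /andP[/fK /le_lt_trans h]; rewrite ltr_pdivlMr// => he; apply: h.
rewrite (le_lt_trans _ he)// mulrC ler_wpM2l ?mod_ge0//; lra.
Qed.

Lemma lip0_qexp n N m (C : 'M[R[i]]_(n, N)) (A : 'M[R[i]]_N) (B : 'M[R[i]]_(N, m)) i j :
  lip0 (fun z => (C *m qexp q A z *m B) i j).
Proof.
have /near0_modP[r r0 rA] := near0_small A.
(* [qexp_dist1] bounds each of the [N^2] entries of [E(z) - 1] by [4 ||A|| |z|]; [K0] adds these
   constants. *)
pose K0 := \sum_(i < N) \sum_(k < N) (4 * mxs A).
have K00 : 0 <= K0.
  by apply: sumr_ge0 => ? _; apply: sumr_ge0 => ? _; rewrite mulr_ge0 ?mxs_ge0.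
exists (mxs C * K0 * mxs B), r; split=> //.
  by rewrite !mulr_ge0 ?mxs_ge0.
move=> z /rA zA; rewrite qexp0//.
have -> : (C *m qexp q A z *m B) i j - (C *m 1%:M *m B) i j =
    (C *m (qexp q A z - 1%:M) *m B) i j.
  by rewrite mulmxBr mulmxBl [in RHS]mxE [X in _ = _ + X]mxE.
rewrite (le_trans (mod_le_mxs _ _ _))// (le_trans (mxsM _ _))//.
rewrite mulrAC ler_wpM2r ?mxs_ge0// (le_trans (mxsM _ _))// -mulrA.
rewrite ler_wpM2l ?mxs_ge0// [leLHS]/mxs /K0 mulr_suml ler_sum// => i' _.
rewrite mulr_suml ler_sum// => k _.
have := @qexp_dist1 _ _ _ A q0 q1 z i' k zA.
by rewrite [cmod z * _]mulrC mulrA !mxE.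
Qed.

Lemma iter_Rq_qexp n N m (C : 'M[R[i]]_(n, N)) (A : 'M[R[i]]_N) (B : 'M[R[i]]_(N, m))
    (T : R[i] -> 'M[R[i]]_(n, m)) (r : R) : 0 < r -> analytic0 T ->
  (forall z, cmod z < r -> small A z /\ T z = C *m qexp q A z *m B) ->
  forall l z, cmod z < r ->
    iter l (@Rq R q n m) T z = C *m qexp q A z *m iter l (mulmx A) B.
Proof.
move=> r0 hT TE; elim=> [|l IH]; first by move=> z /TE[_].
have nz z : z != 0 -> cmod z < r ->
    iter l.+1 (@Rq R q n m) T z = C *m qexp q A z *m iter l.+1 (mulmx A) B.
  move=> z0 zr; have [zA _] := TE z zr.
  rewrite !iterS /Rq (negbTE z0) !IH//; last first.
    by rewrite (le_lt_trans (mod_scale_le _ q0 (ltW q1))).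
  (* The functional equation gives [E(z) - E(qz) = (1 - q) z A E(z)], and [A] then moves past [E(z)]
     onto [B]. *)
  rewrite -mulmxBl -mulmxBr -(qfactor_qexp q0 q1 zA) /qfactor mulmxBl mul1mx subKr.
  rewrite -scalemxAl -scalemxAr -scalemxAl scalerA mulVf ?scale1r.
    by rewrite (qexp_comm q0 q1 zA) !mulmxA.
  by rewrite mulf_neq0// realC_neq1.
move=> z zr; have [->|z0] := eqVneq z 0; last exact: nz.
apply/matrixP => i j.
apply: (lip0_eq (analytic0_lip0 i j (analytic0_iter_Rq l.+1 q0 q1 hT))
                (lip0_qexp C A (iter l.+1 (mulmx A) B) i j) r0).
by move=> w w0 wr; rewrite nz.
Qed.

Lemma qexp_Rq_cyclic n N m (C : 'M[R[i]]_(n, N)) (A : 'M[R[i]]_N) (B : 'M[R[i]]_(N, m))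
    (T : R[i] -> 'M[R[i]]_(n, m)) : analytic0 T ->
  (\forall z \near (0 : R[i]), T z = C *m qexp q A z *m B) -> Rq_cyclic q T.
Proof.
move=> hT TE; have /near0_modP[r r0 rP] :
    \forall z \near (0 : R[i]), small A z /\ T z = C *m qexp q A z *m B.
  exact: filterI (near0_small A) TE.
exists N, (fun k z => col k (C *m qexp q A z)) => l j.
exists (fun k => iter l (mulmx A) B k j).
apply/near0_modP; exists r => // z zr.
rewrite (iter_Rq_qexp r0 hT rP)//; apply/matrixP => i k.
rewrite !mxE summxE; apply: eq_bigr => p _; rewrite !mxE mulrC//.
Qed.

(** Among [p + 1] rows of length [p] there is a linear relation; it is solved for the row of largest
    index [L] with nonzero coefficient. *)
Lemma row_sequence_dependent (K : fieldType) (p : nat) (c : nat -> 'rV[K]_p) :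
  exists (L : nat) (al : 'I_L -> K), c L = \sum_(l < L) al l *: c l.
Proof.
pose M : 'M[K]_(p.+1, p) := \matrix_(l < p.+1) c l.
have : kermx M != 0.
  rewrite kermx_eq0 /row_free; apply/eqP => rM.
  by have := rank_leq_col M; rewrite rM ltnn.
move=> /rowV0Pn[v /sub_kermxP vM v0].
(* The relation is extended by 0 to all naturals, so that [ex_maxnP] can pick its last nonzero
   coefficient. *)
pose w k := if insub k is Some l then v 0 (l : 'I_p.+1) else 0.
have wv (l : 'I_p.+1) : w l = v 0 l by rewrite /w valK.
have sw : \sum_(0 <= l < p.+1) w l *: c l = 0.
  rewrite big_mkord -[RHS]vM mulmx_sum_row; apply: eq_bigr => l _.
  by rewrite wv rowK.
have w_out k : w k != 0 -> (k <= p)%N.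
  by rewrite /w; case: insubP => [l + _ _|]; rewrite ?eqxx// ltnS.
have exw : exists k, w k != 0.
  have /rV0Pn[l vl] := v0; by exists l; rewrite wv.
have [L wL maxL] := ex_maxnP exw w_out.
exists L, (fun l => - (w l / w L)).
move: sw; rewrite (@big_cat_nat _ _ _ L.+1)//=; last by rewrite ltnS w_out.
rewrite [X in _ + X]big_nat_cond [X in _ + X]big1 ?addr0; last first.
  move=> k /andP[/andP[Lk _] _]; suff -> : w k = 0 by rewrite scale0r.
  by apply/eqP; apply: contraTT Lk => /maxL; rewrite -leqNgt.
rewrite big_nat_recr//= => /eqP; rewrite addrC addr_eq0 => /eqP wc.
apply: (scalerI wL); rewrite wc big_mkord scaler_sumr -sumrN.
by apply: eq_bigr => l _; rewrite scalerA mulrN scaleNr mulrC divfK.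
Qed.

Lemma Rq_cyclic_recurrence n m (T : R[i] -> 'M[R[i]]_(n, m)) : Rq_cyclic q T ->
  exists (L : nat) (al : 'I_L -> R[i]), \forall z \near (0 : R[i]),
    iter L (@Rq R q n m) T z = \sum_(l < L) al l *: iter l (@Rq R q n m) T z.
Proof.
move=> [d [g Tg]].
have /choice[c cP] : forall l, exists c : 'M[R[i]]_(d, m),
    \forall z \near (0 : R[i]),
      iter l (@Rq R q n m) T z = (\matrix_(i, k) g k z i 0) *m c.
  move=> l; have /choice[c cP] := Tg l.
  exists (\matrix_(k, j) c j k).
  have := filter_forall (nbhs_filter (0 : R[i])) cP; apply: filterS => z zc.
  apply/matrixP => i j; have /matrixP/(_ i 0) := zc j.
  rewrite !mxE summxE => ->; apply: eq_bigr => k _.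
  by rewrite !mxE mulrC.
have [L [al cL]] := row_sequence_dependent (fun l => mxvec (c l)).
exists L, al.
have {}cL : c L = \sum_(l < L) al l *: c l.
  apply: (can_inj mxvecK); rewrite cL linear_sum.
  by apply: eq_bigr => l _; rewrite linearZ.
(* Only the finitely many [l <= L] occur, so one neighbourhood serves them all. *)
have := filter_forall (nbhs_filter (0 : R[i])) (fun l : 'I_L.+1 => cP l); apply: filterS => z zc.
rewrite (zc ord_max) cL mulmx_sumr; apply: eq_bigr => l _.
by rewrite (zc (widen_ord (leqnSn L) l)) -scalemxAr.
Qed.

(* Companion realization: the state stacks the functions [R_q^l T] for [l < L];
   [sel k i] is the row vector extracting row [i] of [R_q^k T] from it, the case [k = L]
   being given by the recurrence. *)
Lemma recurrence_realization n m (T : R[i] -> 'M[R[i]]_(n, m)) L (al : 'I_L -> R[i]) :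
  analytic0 T ->
  (\forall z \near (0 : R[i]),
    iter L (@Rq R q n m) T z = \sum_(l < L) al l *: iter l (@Rq R q n m) T z) ->
  exists (N : nat) (C : 'M[R[i]]_(n, N)) (A : 'M[R[i]]_N) (B : 'M[R[i]]_(N, m)),
    \forall z \near (0 : R[i]), T z = C *m qexp q A z *m B.
Proof.
move=> hT rec; pose N := #|{: 'I_L * 'I_n}|.
pose dec (p : 'I_N) : 'I_L * 'I_n := enum_val p.
pose S (z : R[i]) : 'M[R[i]]_(N, m) := \matrix_(p, j)
  iter (dec p).1 (@Rq R q n m) T z (dec p).2 j.
pose proj (l : 'I_L) i : 'rV[R[i]]_N := delta_mx 0 (enum_rank (l, i)).
pose sel k i : 'rV[R[i]]_N := if insub k is Some l then proj l i
  else \sum_l al l *: proj l i.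
(* When [L = 0], [sel 0 i] is an empty sum, in accordance with [T = 0] near the origin. *)
pose C : 'M[R[i]]_(n, N) := \matrix_i sel 0%N i.
pose A : 'M[R[i]]_N := \matrix_p sel (dec p).1.+1 (dec p).2.
have projS l i z : proj l i *m S z = row i (iter l (@Rq R q n m) T z).
  by rewrite /proj -rowE; apply/rowP => j; rewrite !mxE /dec enum_rankK.
have /near0_modP[r r0 rP] : \forall z \near (0 : R[i]), small A z /\
    iter L (@Rq R q n m) T z = \sum_(l < L) al l *: iter l (@Rq R q n m) T z.
  exact: filterI (near0_small A) rec.
have selS k i z : cmod z < r -> (k <= L)%N ->
    sel k i *m S z = row i (iter k (@Rq R q n m) T z).
  move=> /rP[_ zL] kL; rewrite /sel; case: insubP => [l _ <-|]; first exact: projS.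
  rewrite -leqNgt => Lk; have -> : k = L by apply/eqP; rewrite eqn_leq kL.
  rewrite zL mulmx_suml linear_sum; apply: eq_bigr => l _.
  by rewrite -scalemxAl projS linearZ.
have CS z : cmod z < r -> C *m S z = T z.
  by move=> zr; apply/row_matrixP => i; rewrite row_mul rowK selS.
have AS z : cmod z < r -> qfactor q A z *m S z = S (qc * z).
  move=> zr; rewrite /qfactor mulmxBl mul1mx -scalemxAl.
  have [->|z0] := eqVneq z 0; first by rewrite !mulr0 scale0r subr0.
  (* Row [p] of [A S(z)] is a row of the next iterate of [Rq], and [(1 - q) z] clears the
     denominator in its definition. *)
  apply/row_matrixP => p; rewrite linearB linearZ/= row_mul rowK selS// iterS.
  apply/rowP => j; rewrite [Rq _ _ z]/Rq (negbTE z0) !mxE mulrA mulfV ?mul1r ?subKr//.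
  by rewrite mulf_neq0// realC_neq1.
exists N, C, A, (S 0); apply/near0_modP; exists r => // z zr.
have [zA _] := rP z zr.
rewrite -(CS z zr) -mulmxA; congr (_ *m _).
have SJ J : S z = qprod_partial q A z J *m S (qc ^+ J * z).
  elim: J => [|J IH]; first by rewrite /qprod_partial big_ord0 mul1mx expr0 mul1r.
  (* [AS] is applied at [q^J z], which stays in the disc of radius [r]. *)
  rewrite IH qprod_partialS -mulmxA exprS -mulrA -AS.
    by rewrite mulKmx// qfactor_unit// small_qXz.
  rewrite mod_qXz// (le_lt_trans _ zr)// ler_piMl ?mod_ge0//.
  by rewrite exprn_ile1// ltW.
apply: (mxcvg_unique (@mxcvg_cst _ _ _ (S z))).
have -> : (fun=> S z) = (fun J => qprod_partial q A z J *m S (qc ^+ J * z)).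
  by apply/funext => J; exact: SJ.
apply: mxcvgM; first exact: qexp_cvg.
move=> p j; rewrite mxE; under eq_fun do rewrite mxE.
exact: lip0_cvg (analytic0_lip0 _ _ (analytic0_iter_Rq _ q0 q1 hT)).
Qed.

End Realization.

Theorem theorem4p2 (R : realType) (q : R) (hq0 : 0 <= q) (hq1 : q < 1)
  (n m : nat) (T : R[i] -> 'M[R[i]]_(n, m)) (hT : analytic0 T) :
  Rq_cyclic q T <->
  exists (N : nat) (Cq : 'M[R[i]]_(n, N)) (Aq : 'M[R[i]]_N) (Bq : 'M[R[i]]_(N, m)),
    \forall z \near (0 : R[i]),
      exists P : 'M[R[i]]_N,
        (forall i k : 'I_N, (fun J : nat => qprod_partial q Aq z J i k) @ \oo --> P i k)
        /\ T z = Cq *m P *m Bq.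

Proof.
split=> [/Rq_cyclic_recurrence[L [al /(recurrence_realization hq0 hq1 hT)]]|].
  move=> [N [C [A [B TE]]]]; exists N, C, A, B.
  apply: filterS2 (near0_small A) TE => z zA Tz.
  by exists (qexp q A z); split; first exact: qexp_cvg.
move=> [N [C [A [B TE]]]]; apply: (qexp_Rq_cyclic hq0 hq1 hT (C := C) (A := A) (B := B)).
(* The limit [P] is given separately at each [z]; uniqueness of limits identifies it with
   [qexp q A z]. *)
apply: filterS2 (near0_small A) TE => z zA [P [cP ->]].
by congr (_ *m _ *m _); exact: mxcvg_unique cP (qexp_cvg hq0 hq1 zA).
Qed.
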